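(* $\textsc{Inclusion-Exclusion}$ reduces (by a decision tree reduction of $\mathrm{polylog}(N)$ complexity) to $\textsc{Lossy-Code}$.
   Context: Query model: inputs accessed by bit queries; a decision tree reduction computes each target-input bit by a decision tree over the source input and maps target solutions to source solutions by decision trees, complexity = log target input length + max depth. $\textsc{Lossy-Code}$: given $f:[M]\to[2M]$, $g:[2M]\to[M]$, find $x\in[2M]$ with $f(g(x))\ne x$. $\textsc{Inclusion-Exclusion}$: parameters $N$, $\ell\le\mathrm{polylog}(N)$, $\varepsilon>1/\mathrm{polylog}(N)$; a table $T\subseteq[\ell]\times[N]$ defining sets $S_i=\{j: T_{i,j}=1\}$; numbers $0\le a_i\le N$ ($i\in[\ell]$) and $0\le a_{i,j}\le N$ ($1\le i<j\le\ell$); let $\tilde a=\sum_i a_i-\sum_{i<j}a_{i,j}$, assumed to satisfy $\tilde a\ge\varepsilon N$; maps $f_i:[a_i]\to[N]$, $g_i:[N]\to[a_i]$; maps $f_{i,j}:[a_{i,j}]\to[N]$, $g_{i,j}:[N]\to[a_{i,j}]$; and maps $\tilde f:[\tilde a-\varepsilon N]\to[N]$, $\tilde g:[N]\to[\tilde a-\varepsilon N]$. A solution is (s1) some $i$ and $x\in[a_i]$ with $T_{i,f_i(x)}=0$ or $g_i(f_i(x))\ne x$; (s2) some $i<j$ and $x\in[N]$ with $T_{i,x}=T_{j,x}=1$ but $f_{i,j}(g_{i,j}(x))\ne x$; or (s3) some $x\in[N]$ with $\tilde f(\tilde g(x))\ne x$ and $T_{j,x}=1$ for some $j\in[\ell]$.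 *)

(* Defs.v *)
From HB Require Import structures.
From mathcomp Require Import all_boot all_order all_algebra.

Set Implicit Arguments.
Unset Strict Implicit.
Unset Printing Implicit Defensive.

Import Order.TTheory GRing.Theory Num.Theory.

(* The factor is the bit length floor(log2 N) + 1 rather than log N, which
   vanishes at N = 1. *)
Definition polylog (p : nat -> nat) : Prop :=
  exists c, forall N, p N <= c * (trunc_log 2 N).+1 ^ c.

Inductive dtree (Q A : Type) : Type :=
| Leaf of A
| Node of Q & dtree Q A & dtree Q A.

Arguments Leaf {Q A} _.
Arguments Node {Q A} _ _ _.

Fixpoint eval (Q A : Type) (ans : Q -> bool) (t : dtree Q A) : A :=
  match t with
  | Leaf a => a
  | Node q t0 t1 => if ans q then eval ans t1 else eval ans t0
  end.

Fixpoint depth (Q A : Type) (t : dtree Q A) : nat :=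
  match t with
  | Leaf _ => 0
  | Node _ t0 t1 => (maxn (depth t0) (depth t1)).+1
  end.

(* A search problem at fixed parameters: query is the set of bit positions, so
   #|query P| is the input length in bits. *)
Record problem := Problem {
  input : Type;
  query : finType;
  bit : input -> query -> bool;
  output : finType;
  solves : input -> output -> Prop }.

Record reduction (P Q : problem) := Reduction {
  in_tree : query Q -> dtree (query P) bool;
  out_tree : output Q -> dtree (query P) (output P);
  reductionP : forall x : input P, exists y : input Q,
    (forall q, bit y q = eval (bit x) (in_tree q)) /\
    (forall o, solves y o -> solves x (eval (bit x) (out_tree o))) }.

Definition complexity (P Q : problem) (r : reduction P Q) : nat :=
  up_log 2 #|query Q| +
  maxn (\max_q depth (in_tree r q)) (\max_o depth (out_tree r o)).

(* The set [n] is 'I_n, and an element of it is written in binary on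
   up_log 2 n = ceil(log2 n) bits; nbit k b is the bit of weight 2 ^ b. *)
Definition nbit (k b : nat) : bool := odd (k %/ 2 ^ b).

Section LossyCode.
Variable M : nat.

Record lossy_input := LossyInput {
  lc_f : 'I_M -> 'I_(2 * M);
  lc_g : 'I_(2 * M) -> 'I_M }.

Definition lossy_query : finType :=
  (('I_M * 'I_(up_log 2 (2 * M))) + ('I_(2 * M) * 'I_(up_log 2 M)))%type.

Definition lossy_bit (I : lossy_input) (q : lossy_query) : bool :=
  match q with
  | inl (x, b) => nbit (lc_f I x) b
  | inr (x, b) => nbit (lc_g I x) b
  end.

Definition lossy_solves (I : lossy_input) (x : 'I_(2 * M)) : Prop :=
  lc_f I (lc_g I x) <> x.

Definition lossy_code : problem :=
  @Problem lossy_input lossy_query lossy_bit 'I_(2 * M) lossy_solves.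

End LossyCode.

(* A map into [n] is encoded with values in option 'I_n; it is an everywhere
   defined map when n > 0, and n = 0 is the only case in which it may be
   undefined, as [0] receives no map from a nonempty set. *)
Definition total_into (A : Type) (n : nat) (g : A -> option 'I_n) : Prop :=
  0 < n -> forall x, isSome (g x).

Definition value_bit (n : nat) (v : option 'I_n) (b : nat) : bool :=
  if v is Some y then nbit y b else false.

(* The table of f is laid out on a number of entries that does not depend on
   the (queried) size of the domain; entries outside of the domain read 0. *)
Definition table_bit (m n : nat) (f : 'I_m -> 'I_n) (x b : nat) : bool :=
  if insub x is Some y then nbit (f y) b else false.

Section InclusionExclusion.
Variables (R : archiRealFieldType) (N l : nat) (eps : R).

Definition pairs : finType := {p : 'I_l * 'I_l | p.1 < p.2}.

Definition fst_idx (p : pairs) : 'I_l := (val p).1.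
Definition snd_idx (p : pairs) : 'I_l := (val p).2.

Definition ie_total (a : 'I_l -> 'I_N.+1) (aa : pairs -> 'I_N.+1) : int :=
  (\sum_i (a i)%:Z - \sum_p (aa p)%:Z)%R.

(* For real r >= 0, [r] is read as [floor r]. *)
Definition ie_reduced (a : 'I_l -> 'I_N.+1) (aa : pairs -> 'I_N.+1) : nat :=
  Num.truncn ((ie_total a aa)%:~R - eps * N%:R : R)%R.

Record ie_input := IEInput {
  ie_T : 'I_l -> 'I_N -> bool;
  ie_a : 'I_l -> 'I_N.+1;
  ie_aa : pairs -> 'I_N.+1;
  ie_gap : (eps * N%:R <= (ie_total ie_a ie_aa)%:~R)%R;
  ie_f : forall i, 'I_(ie_a i) -> 'I_N;
  ie_g : forall i, 'I_N -> option 'I_(ie_a i);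
  ie_g_total : forall i, total_into (ie_g i);
  ie_ff : forall p, 'I_(ie_aa p) -> 'I_N;
  ie_gg : forall p, 'I_N -> option 'I_(ie_aa p);
  ie_gg_total : forall p, total_into (ie_gg p);
  ie_ft : 'I_(ie_reduced ie_a ie_aa) -> 'I_N;
  ie_gt : 'I_N -> option 'I_(ie_reduced ie_a ie_aa);
  ie_gt_total : total_into ie_gt }.

Inductive ie_query : Type :=
| QT of 'I_l & 'I_N
| Qa of 'I_l & 'I_(up_log 2 N.+1)
| Qaa of pairs & 'I_(up_log 2 N.+1)
| Qf of 'I_l & 'I_N & 'I_(up_log 2 N)
| Qg of 'I_l & 'I_N & 'I_(up_log 2 N)
| Qff of pairs & 'I_N & 'I_(up_log 2 N)
| Qgg of pairs & 'I_N & 'I_(up_log 2 N)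
| Qft of 'I_(l * N) & 'I_(up_log 2 N)
| Qgt of 'I_N & 'I_(up_log 2 (l * N)).

Definition ie_bit (I : ie_input) (q : ie_query) : bool :=
  match q with
  | QT i x => ie_T I i x
  | Qa i b => nbit (ie_a I i) b
  | Qaa p b => nbit (ie_aa I p) b
  | Qf i x b => table_bit (@ie_f I i) x b
  | Qg i x b => value_bit (ie_g I i x) b
  | Qff p x b => table_bit (@ie_ff I p) x b
  | Qgg p x b => value_bit (ie_gg I p x) b
  | Qft x b => table_bit (@ie_ft I) x b
  | Qgt x b => value_bit (ie_gt I x) b
  end.

Definition ie_query_code (q : ie_query) :
    ('I_l * 'I_N + 'I_l * 'I_(up_log 2 N.+1) + pairs * 'I_(up_log 2 N.+1)
     + 'I_l * 'I_N * 'I_(up_log 2 N) + 'I_l * 'I_N * 'I_(up_log 2 N)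
     + pairs * 'I_N * 'I_(up_log 2 N) + pairs * 'I_N * 'I_(up_log 2 N)
     + 'I_(l * N) * 'I_(up_log 2 N) + 'I_N * 'I_(up_log 2 (l * N)))%type :=
  match q with
  | QT i x => inl (inl (inl (inl (inl (inl (inl (inl (i, x))))))))
  | Qa i b => inl (inl (inl (inl (inl (inl (inl (inr (i, b))))))))
  | Qaa p b => inl (inl (inl (inl (inl (inl (inr (p, b)))))))
  | Qf i x b => inl (inl (inl (inl (inl (inr (i, x, b))))))
  | Qg i x b => inl (inl (inl (inl (inr (i, x, b)))))
  | Qff p x b => inl (inl (inl (inr (p, x, b))))
  | Qgg p x b => inl (inl (inr (p, x, b)))
  | Qft x b => inl (inr (x, b))
  | Qgt x b => inr (x, b)
  end.

Definition ie_query_decode c : ie_query :=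
  match c with
  | inl (inl (inl (inl (inl (inl (inl (inl (i, x)))))))) => QT i x
  | inl (inl (inl (inl (inl (inl (inl (inr (i, b)))))))) => Qa i b
  | inl (inl (inl (inl (inl (inl (inr (p, b))))))) => Qaa p b
  | inl (inl (inl (inl (inl (inr (i, x, b)))))) => Qf i x b
  | inl (inl (inl (inl (inr (i, x, b))))) => Qg i x b
  | inl (inl (inl (inr (p, x, b)))) => Qff p x b
  | inl (inl (inr (p, x, b))) => Qgg p x b
  | inl (inr (x, b)) => Qft x b
  | inr (x, b) => Qgt x b
  end.

Lemma ie_query_codeK : cancel ie_query_code ie_query_decode.
Proof. by case. Qed.

HB.instance Definition _ := Finite.copy ie_query (can_type ie_query_codeK).

(* The size of [a_i] depends on the input, so the candidate x of type (s1) is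
   named by an element of [N], which contains [a_i]. *)
Inductive ie_output : Type :=
| S1 of 'I_l & 'I_N
| S2 of pairs & 'I_N
| S3 of 'I_N.

Definition ie_output_code (o : ie_output) :
    ('I_l * 'I_N + pairs * 'I_N + 'I_N)%type :=
  match o with
  | S1 i x => inl (inl (i, x))
  | S2 p x => inl (inr (p, x))
  | S3 x => inr x
  end.

Definition ie_output_decode c : ie_output :=
  match c with
  | inl (inl (i, x)) => S1 i x
  | inl (inr (p, x)) => S2 p x
  | inr x => S3 x
  end.

Lemma ie_output_codeK : cancel ie_output_code ie_output_decode.
Proof. by case. Qed.

HB.instance Definition _ := Finite.copy ie_output (can_type ie_output_codeK).

Definition ie_solves (I : ie_input) (o : ie_output) : Prop :=
  match o with
  | S1 i x => exists y : 'I_(ie_a I i), (y = x :> nat) /\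
      (ie_T I i (ie_f y) = false \/ ie_g I i (ie_f y) <> Some y)
  | S2 p x => [/\ ie_T I (fst_idx p) x, ie_T I (snd_idx p) x
                & omap (@ie_ff I p) (ie_gg I p x) <> Some x]
  | S3 x => omap (@ie_ft I) (ie_gt I x) <> Some x /\
      (exists j, ie_T I j x)
  end.

Definition inclusion_exclusion : problem :=
  @Problem ie_input ie_query ie_bit ie_output ie_solves.

End InclusionExclusion.

(* Main.v *)
(* The injection behind Bonferroni's inequality
     \sum_i |S_i| <= |\bigcup_i S_i| + \sum_(i < j) |S_i \cap S_j|
   sends x \in S_j to the pair (i, j) and x if x lies in some S_i with i < j, and
   to x itself otherwise. Composed with the f's and g's it becomes a map from
   [a_1] + ... + [a_l] to [\tilde a - eps N] + \sum_(i < j) [a_{i,j}] with a left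
   inverse, except at points that reveal a solution; every map involved is
   computed by a shallow decision tree. Padding the domain to [l] * [N] makes it
   independent of the queried sizes, and the codomain then has at most
   l N - eps N elements. As this shrinks only by a factor 1 - eps / l, the map is
   repeated in parallel on l p(N) >= l / eps coordinates, which gains a factor 2
   while the logarithm of the domain size stays polylogarithmic. *)

Require Import Defs.
From HB Require Import structures.
From mathcomp Require Import all_boot all_order all_algebra.
From mathcomp Require Import zify lra.

Set Implicit Arguments.
Unset Strict Implicit.
Unset Printing Implicit Defensive.

Import Order.TTheory GRing.Theory Num.Theory.

(** * Closure of polylogarithmic bounds under sums and products *)

Definition bits (N : nat) : nat := (trunc_log 2 N).+1.

Lemma ltn_exp_bits (N : nat) : N < 2 ^ bits N.
Proof. exact: trunc_log_ltn. Qed.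

Lemma polylog_const (k : nat) : polylog (fun=> k).
Proof. by exists k => N; rewrite leq_pmulr // expn_gt0. Qed.

Lemma polylog_bits : polylog bits.
Proof. by exists 1 => N; rewrite mul1n expn1. Qed.

Lemma polylogD (p q : nat -> nat) :
  polylog p -> polylog q -> polylog (fun N => p N + q N).
Proof.
move=> [c hc] [d hd]; exists (c + d) => N; rewrite mulnDl.
apply: leq_add.
  by apply: leq_trans (hc N) _; rewrite leq_mul2l leq_pexp2l ?leq_addr ?orbT.
by apply: leq_trans (hd N) _; rewrite leq_mul2l leq_pexp2l ?leq_addl ?orbT.
Qed.

Lemma polylogM (p q : nat -> nat) :
  polylog p -> polylog q -> polylog (fun N => p N * q N).
Proof.
move=> [c hc] [d hd]; exists (c * d + c + d) => N.
apply: leq_trans (leq_mul (hc N) (hd N)) _.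
rewrite mulnACA -expnD; apply: leq_mul; first by rewrite -addnA leq_addr.
by rewrite leq_pexp2l // -addnA leq_addl.
Qed.

Lemma nbit_inj (k m n : nat) : m < 2 ^ k -> n < 2 ^ k ->
  (forall b, b < k -> nbit m b = nbit n b) -> m = n.
Proof.
elim: k m n => [|k IHk] m n; first by case: m n => [|m] [|n].
rewrite expnS mul2n => hm hn eq_mn.
rewrite -(odd_double_half m) -(odd_double_half n).
have := eq_mn 0 isT; rewrite /nbit expn0 !divn1 => ->.
congr (_ + _.*2); apply: IHk => [||b hb]; rewrite ?ltn_half_double //.
by have := eq_mn b.+1 hb; rewrite /nbit expnS !divnMA !divn2.
Qed.

(** * Functions of the input computed by shallow decision trees *)

Section Computability.
Variable P : problem.

(** A sigma type, so that the trees can be extracted with [sval] as components of a reduction. *)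
Definition computed (A : Type) (d : nat) (phi : input P -> A) : Type :=
  {t : dtree (query P) A |
    depth t <= d /\ forall x, eval (bit x) t = phi x}.

Lemma computed_le A d e (phi : input P -> A) :
  d <= e -> computed d phi -> computed e phi.
Proof. by move=> le_de [t [ht ev_t]]; exists t; split=> //; apply: leq_trans le_de. Qed.

Lemma computed_eq A d (phi psi : input P -> A) :
  computed d phi -> (forall x, phi x = psi x) -> computed d psi.
Proof. by move=> [t [ht ev_t]] eq_phi; exists t; split=> // x; rewrite ev_t. Qed.

Lemma computed_const A (a : A) : computed 0 (fun=> a).
Proof. by exists (Leaf a). Qed.

Lemma computed_query (q : query P) : computed 1 (fun x => bit x q).
Proof.
by exists (Node q (Leaf false) (Leaf true)); split=> //= x; case: (bit x q).
Qed.

Fixpoint bind (A B : Type) (t : dtree (query P) A)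
    (k : A -> dtree (query P) B) : dtree (query P) B :=
  match t with
  | Leaf a => k a
  | Node q t0 t1 => Node q (bind t0 k) (bind t1 k)
  end.

(** The tree for [psi a] is grafted onto each leaf [a] of the tree for [phi]; later queries may thus
    depend on earlier answers. *)
Lemma computed_bind A B d e (phi : input P -> A) (psi : A -> input P -> B) :
  computed d phi -> (forall a, computed e (psi a)) ->
  computed (d + e) (fun x => psi (phi x) x).
Proof.
move=> [t [ht ev_t]] hpsi; exists (bind t (fun a => sval (hpsi a))); split.
  have {}ht : depth t + e <= d + e by rewrite leq_add2r.
  apply: leq_trans ht; elim: t {ev_t} => /= [a|q t0 IH0 t1 IH1].
    by have [] := svalP (hpsi a).
  rewrite addSn ltnS geq_max addn_maxl leq_max IH0 leq_max IH1 orbT //.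
move=> x; rewrite -ev_t; elim: t {ht ev_t} => /= [a|q t0 IH0 t1 IH1].
  by have [_ ->] := svalP (hpsi a).
by case: (bit x q).
Qed.

Lemma computed_map A B d (phi : input P -> A) (psi : A -> B) :
  computed d phi -> computed d (fun x => psi (phi x)).
Proof.
move=> hphi; rewrite -[d]addn0.
by apply: (computed_bind (psi := fun a _ => psi a)) hphi _ => a; apply: computed_const.
Qed.

Lemma computed_ffun (I : finType) A d (a0 : A) (phi : I -> input P -> A) :
  (forall i, computed d (phi i)) ->
  computed (#|I| * d) (fun x => [ffun i => phi i x]).
Proof.
move=> hphi.
have hs (s : seq I) : computed (size s * d) (fun x => [seq phi i x | i <- s]).
  elim: s => [|i s IHs] /=; first exact: computed_const.
  rewrite mulSn.
  apply: (computed_bind (psi := fun a x => a :: [seq phi i x | i <- s])) => //.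
  by move=> a; apply: computed_map IHs.
rewrite cardE.
apply: computed_eq (computed_map
  (fun s => [ffun i : I => nth a0 s (enum_rank i)]) (hs (enum I))) _ => x.
apply/ffunP => i; rewrite !ffunE (nth_map i) ?nth_enum_rank //.
by rewrite -cardE.
Qed.

(** All bits are queried, then the element with these bits is looked up; it is unique by [nbit_inj].
    [i0] covers bit patterns that belong to no element. *)
Lemma computed_ord n (i0 : 'I_n) d (phi : input P -> 'I_n) :
  (forall b : 'I_(up_log 2 n), computed d (fun x => nbit (phi x) b)) ->
  computed (up_log 2 n * d) phi.
Proof.
move=> hphi; have := computed_ffun false hphi; rewrite card_ord => hbits.
apply: computed_eq (computed_map (fun bs : {ffun 'I_(up_log 2 n) -> bool} =>
  odflt i0 [pick i : 'I_n | [forall b : 'I__, nbit i b == bs b]]) hbits) _ => x.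
case: pickP => [i /= /forallP eq_i|/(_ (phi x))/=]; last first.
  by move/negbT/forallP; case=> b; rewrite ffunE.
apply: val_inj => /=; apply: (@nbit_inj (up_log 2 n)).
- exact: leq_trans (ltn_ord i) (up_logP n (isT : 1 < 2)).
- exact: leq_trans (ltn_ord (phi x)) (up_logP n (isT : 1 < 2)).
- by move=> b hb; have /eqP := eq_i (Ordinal hb); rewrite ffunE.
Qed.

End Computability.

(** * Lossy-Code as a target of reductions *)

Lemma card_bij (A : finType) n : #|A| = n ->
  {f : A -> 'I_n & {g : 'I_n -> A | cancel f g & cancel g f}}.
Proof.
by move=> <-; exists enum_rank; exists enum_val; [apply: enum_rankK | apply: enum_valK].
Qed.

Lemma card_pinj (A : finType) n : #|A| <= n ->
  {f : A -> 'I_n & {g : 'I_n -> option A | pcancel f g}}.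
Proof.
move=> hA; exists (fun a => widen_ord hA (enum_rank a)).
exists (fun i => omap (fun j : 'I_#|A| => enum_val j) (insub (val i))) => a /=.
by rewrite valK /= enum_rankK.
Qed.

(** A crude estimate is enough, as only its logarithm enters the complexity. *)
Lemma card_lossy_query M : 0 < M -> #|lossy_query M| <= 2 ^ 2 * M ^ 2.
Proof.
move=> M0; rewrite card_sum !card_prod !card_ord.
have up_log_le n : up_log 2 n <= n by apply: up_log_min => //; apply/ltnW/ltn_expl.
apply: (@leq_trans (M * (2 * M) + 2 * M * M)); last by lia.
by rewrite leq_add // leq_mul2l up_log_le orbT.
Qed.

(* t-fold parallel repetition: [dec \o enc] is the identity on tuples without a
   bad coordinate, and 2 K^t <= #|E|^t codes leave room for the extra bit that
   distinguishes [2M] from [M]. *)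
Lemma lossy_code_reduction (P : problem) (E : finType) (K t d : nat)
    (enc : input P -> E -> option 'I_K) (dec : input P -> 'I_K -> E)
    (sol : input P -> E -> option (output P)) (e0 : E) (o0 : output P) :
  2 * K ^ t <= #|E| ^ t ->
  (forall e, computed d (fun x => enc x e)) ->
  (forall k, computed d (fun x => dec x k)) ->
  (forall e, computed d (fun x => sol x e)) ->
  (forall x e o, sol x e = Some o -> solves x o) ->
  (forall x e, sol x e = None -> omap (dec x) (enc x e) = Some e) ->
  exists r : reduction P (lossy_code (#|E| ^ t)),
    complexity r <= up_log 2 #|lossy_query (#|E| ^ t)| + t * d.
Proof.
set M := #|E| ^ t => hKt henc hdec hsol sol_sound encK.
pose X : finType := {ffun 'I_t -> E}; pose Y : finType := {ffun 'I_t -> 'I_K}.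
have [c1 [d1 c1K d1K]] : {f : bool * X -> 'I_(2 * M) &
    {g : 'I_(2 * M) -> (bool * X)%type | cancel f g & cancel g f}}.
  by apply: card_bij; rewrite card_prod card_bool card_ffun card_ord.
(* By [hKt], two copies of the set of code tuples fit into [M]. *)
have [c2 [d2 c2K]] : {f : bool * Y -> 'I_M &
    {g : 'I_M -> option (bool * Y)%type | pcancel f g}}.
  by apply: card_pinj; rewrite card_prod card_bool card_ffun !card_ord.
have M0 : 0 < M by rewrite expn_gt0; apply/orP; left; apply/card_gt0P; exists e0.
(* A tuple with a coordinate that has no code goes to an arbitrary element; such a coordinate always
   yields a solution. *)
pose gpost (b : bool) (w : {ffun 'I_t -> option 'I_K}) : 'I_M :=
  if [pick y : Y | [forall k, w k == Some (y k)]] is Some y then c2 (b, y)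
  else Ordinal M0.
pose g x (i : 'I_(2 * M)) := gpost (d1 i).1 [ffun k => enc x ((d1 i).2 k)].
pose f x (j : 'I_M) : 'I_(2 * M) :=
  if d2 j is Some (b, y) then c1 (b, [ffun k => dec x (y k)])
  else c1 (true, [ffun=> e0]).
pose outpost (w : {ffun 'I_t -> option (output P)}) : output P :=
  odflt o0 (obind w [pick k | isSome (w k)]).
pose out x (i : 'I_(2 * M)) := outpost [ffun k => sol x ((d1 i).2 k)].
have cffun A (a0 : A) (phi : 'I_t -> input P -> A) :
    (forall k, computed d (phi k)) ->
    computed (t * d) (fun x => [ffun k => phi k x]).
  by move=> hphi; have := computed_ffun a0 hphi; rewrite card_ord.
have cg i : computed (t * d) (fun x => g x i).
  by apply: computed_map; apply: (cffun _ None) => k; apply: henc.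
have cf j : computed (t * d) (fun x => f x j).
  rewrite /f; case: (d2 j) => [[b y]|]; last first.
    exact: computed_le (computed_const _ _).
  apply: (computed_map (fun v : X => c1 (b, v))).
  by apply: (cffun _ e0) => k; apply: hdec.
have co i : computed (t * d) (fun x => out x i).
  by apply: computed_map; apply: (cffun _ None) => k; apply: hsol.
have cin (q : lossy_query M) : computed (t * d)
    (fun x => lossy_bit (LossyInput (f x) (g x)) q).
  case: q => -[i b].
    exact: (computed_map (fun v : 'I__ => nbit v b) (cf i)).
  exact: (computed_map (fun v : 'I__ => nbit v b) (cg i)).
have red x : exists y : lossy_input M,
    (forall q, lossy_bit y q = eval (bit x) (sval (cin q))) /\
    (forall o, lossy_solves y o -> solves x (eval (bit x) (sval (co o)))).
  exists (LossyInput (f x) (g x)); split=> [q|i].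
    by have [_ ->] := svalP (cin q).
  have [_ ->] := svalP (co i); rewrite /lossy_solves /= => fgi.
  rewrite /out /outpost; case: pickP => [k|nosol]; first rewrite ffunE.
    by case solk: (sol x _) => [o|] //= _; rewrite ffunE solk; apply: sol_sound solk.
  (* No coordinate reports a solution, so all are decoded correctly and f (g i) = i. *)
  case: fgi; rewrite /g /gpost.
  have {}encK k : omap (dec x) (enc x ((d1 i).2 k)) = Some ((d1 i).2 k).
    by apply: encK; have := nosol k; rewrite ffunE; case: (sol x _).
  case: pickP => [y /forallP wy|noy].
    rewrite /f c2K -[RHS]d1K; congr c1; rewrite [RHS]surjective_pairing.
    congr pair; apply/ffunP => k; rewrite ffunE.
    by have /eqP := wy k; have := encK k; rewrite ffunE => + eqk; rewrite eqk => -[].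
  (* [K] might be 0, so the default for [odflt] is extracted from the code of a coordinate. *)
  have K0 (k : 'I_t) : 'I_K by have := encK k; case: (enc x _).
  have /forallP[] := negbT (noy [ffun k => odflt (K0 k) (enc x ((d1 i).2 k))]).
  by move=> k; rewrite !ffunE; have := encK k; case: (enc x _).
exists (@Reduction P (lossy_code M) _ _ red); rewrite /complexity leq_add2l geq_max.
by apply/andP; split; apply/bigmax_leqP => i _ /=; [case: (svalP (cin i)) | case: (svalP (co i))].
Qed.

(** Correctness is vacuous, so constant trees suffice. This disposes of the case l = 0. *)
Lemma empty_reduction (P : problem) (o0 : output P) : (input P -> False) ->
  exists r : reduction P (lossy_code 1), complexity r <= 4.
Proof.
move=> noP.
have red x : exists y : input (lossy_code 1),
    (forall q, bit y q = eval (bit x) (Leaf false)) /\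
    (forall o, solves y o -> solves x (eval (bit x) (Leaf o0))).
  by case: (noP x).
exists (@Reduction P (lossy_code 1) (fun=> Leaf false) (fun=> Leaf o0) red).
rewrite /complexity (eq_bigr (fun=> 0)) // big1_eq.
rewrite (eq_bigr (fun=> 0)) // big1_eq maxnn addn0.
by apply: up_log_min => //; apply: leq_trans (card_lossy_query _) _.
Qed.

(** For B > 0 the assumption says K / B <= 1 - 1 / s, and (1 - 1 / s)^s <= 1 / 2. *)
Lemma double_exp_le (K B s : nat) :
  0 < s -> K * s + B <= B * s -> 2 * K ^ s <= B ^ s.
Proof.
move=> s0 hK.
have le_KB : K <= B by rewrite -(leq_pmul2r s0); apply: leq_trans hK; apply: leq_addr.
(* A division-free form of (K / B)^j <= s / (s + j); j = s gives the factor 2. The induction uses K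
   (s + j + 1) <= B (s + j). *)
have key j : K ^ j * (s + j) <= B ^ j * s.
  elim: j => [|j IHj]; first by rewrite !expn0 addn0.
  rewrite !expnS -[B * _ * s]mulnA; apply: leq_trans (leq_mul (leqnn B) IHj).
  rewrite mulnCA mulnAC mulnC leq_mul2l; apply/orP; right.
  nia.
by have := key s; rewrite addnn -mul2n mulnA leq_pmul2r // mulnC.
Qed.

(** * Numbers read off the bits of the input *)

Definition to_ord (n : nat) (n0 : 0 < n) (k : nat) : 'I_n := insubd (Ordinal n0) k.

Lemma to_ordK n (n0 : 0 < n) k : k < n -> to_ord n0 k = k :> nat.
Proof. by move=> hk; rewrite val_insubd hk. Qed.

Lemma computed_read (P : problem) n (n0 : 0 < n)
    (q : 'I_(up_log 2 n) -> query P) (phi : input P -> nat) :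
  (forall x, phi x < n) -> (forall x b, bit x (q b) = nbit (phi x) b) ->
  computed (up_log 2 n) (fun x => to_ord n0 (phi x)).
Proof.
move=> hphi hq; rewrite -[up_log 2 n]muln1; apply: (computed_ord (Ordinal n0)) => b.
by apply: computed_eq (computed_query (q b)) _ => x; rewrite hq to_ordK.
Qed.

Definition value (n : nat) (v : option 'I_n) : nat := oapp (@nat_of_ord n) 0 v.

Definition entry (m n : nat) (f : 'I_m -> 'I_n) (x : nat) : nat :=
  value (omap f (insub x)).

Lemma value_bitE n (v : option 'I_n) b : value_bit v b = nbit (value v) b.
Proof. by case: v => //=; rewrite /nbit div0n. Qed.

Lemma table_bitE m n (f : 'I_m -> 'I_n) x b : table_bit f x b = nbit (entry f x) b.
Proof. by rewrite /table_bit /entry; case: insubP => //=; rewrite /nbit div0n. Qed.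

Lemma entry_ord m n (f : 'I_m -> 'I_n) (y : 'I_m) : entry f y = f y :> nat.
Proof. by rewrite /entry valK. Qed.

Lemma ltn_value m n (v : option 'I_m) : 0 < n -> m <= n -> value v < n.
Proof. by case: v => //= y _; apply: leq_trans. Qed.

Lemma ltn_entry m n (f : 'I_m -> 'I_n) x : 0 < n -> entry f x < n.
Proof. by move=> n0; apply: ltn_value. Qed.

Lemma sum_ord_lt m r : \sum_(z < m | z < r) 1 = minn m r.
Proof.
rewrite big_mkcond; elim: m => [|m IHm]; first by rewrite big_ord0 min0n.
by rewrite big_ord_recr /= IHm; case: ltnP; lia.
Qed.

Lemma sum_ord_ge m r : \sum_(z < m | r <= z) 1 = m - r.
Proof.
rewrite big_mkcond; elim: m => [|m IHm]; first by rewrite big_ord0.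
by rewrite big_ord_recr /= IHm; case: leqP; lia.
Qed.

(** * The set of codes and its size *)

Section InclusionExclusionReduction.
Variables (R : archiRealFieldType) (N l : nat) (eps : R).
Hypotheses (N0 : 0 < N) (l0 : 0 < l) (eps0 : (0 < eps)%R).

Local Notation IE := (inclusion_exclusion N l eps).
Local Notation sizes := {ffun 'I_l -> 'I_N.+1}.
Local Notation pair_sizes := {ffun pairs l -> 'I_N.+1}.
Local Notation column := {ffun 'I_l -> bool}.

Lemma lN0 : 0 < l * N.
Proof. by rewrite muln_gt0 l0 N0. Qed.

(* The codes are values of [\tilde g], values of the g_{i,j}, and the pairs (i, y)
   with y outside of [a_i], which are mapped to themselves so that the domain
   'I_l * 'I_N does not depend on the input. *)
Definition code : finType :=
  ('I_(l * N) + pairs l * 'I_N + 'I_l * 'I_N)%type.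

Definition codes (A : sizes) (AA : pair_sizes) : {set code} :=
  [set u : code | match u with
                  | inl (inl z) => z < ie_reduced eps A AA
                  | inl (inr (p, z)) => z < AA p
                  | inr (i, y) => A i <= y
                  end].

Definition code_bound : nat := Num.truncn ((l * N)%:R - eps * N%:R : R)%R.

Lemma ie_reduced_le (A : 'I_l -> 'I_N.+1) (AA : pairs l -> 'I_N.+1) :
  (eps * N%:R <= (ie_total A AA)%:~R)%R ->
  ((ie_reduced eps A AA)%:R <= \sum_i (A i)%:R - \sum_p (AA p)%:R - eps * N%:R :> R)%R.
Proof.
rewrite /ie_reduced /ie_total => gap.
have -> : (\sum_i (A i)%:R - \sum_p (AA p)%:R - eps * N%:R =
           (\sum_i (A i)%:Z - \sum_p (AA p)%:Z)%:~R - eps * N%:R :> R)%R.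
  by rewrite rmorphB !rmorph_sum /=.
by rewrite truncn_le ?subr_ge0.
Qed.

Lemma sum_sizes_le (A : 'I_l -> 'I_N.+1) : \sum_i A i <= l * N.
Proof.
rewrite -[l in l * N]card_ord -sum_nat_const; apply: leq_sum => i _.
by rewrite -ltnS.
Qed.

(** Makes the values of \tilde g fit into the range ['I_(l * N)] in which they are read. *)
Lemma ie_reduced_le_lN (A : 'I_l -> 'I_N.+1) (AA : pairs l -> 'I_N.+1) :
  (eps * N%:R <= (ie_total A AA)%:~R)%R -> ie_reduced eps A AA <= l * N.
Proof.
move=> /ie_reduced_le; have := sum_sizes_le A.
rewrite -2!(ler_nat R) -!natr_sum.
have : (0 <= eps * N%:R)%R by rewrite mulr_ge0 ?ler0n ?ltW.
have : (0 <= (\sum_p AA p)%N%:R :> R)%R by exact: ler0n.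
lra.
Qed.

(** The three kinds of codes number at most \tilde a - eps N, \sum a_{i,j} and l N - \sum a_i; the
    queried sizes cancel in the sum. *)
Lemma card_codes (A : sizes) (AA : pair_sizes) :
  (eps * N%:R <= (ie_total A AA)%:~R)%R -> #|codes A AA| <= code_bound.
Proof.
move=> gap; have hr := ie_reduced_le gap.
have : #|codes A AA| <= ie_reduced eps A AA + \sum_p AA p + (l * N - \sum_i A i).
  rewrite -sum1_card !big_sumType /=; apply: leq_add; first apply: leq_add.
  - rewrite (eq_bigl (fun z : 'I_(l * N) => z < ie_reduced eps A AA)).
      by rewrite sum_ord_lt geq_minr.
    by move=> z; rewrite inE.
  - rewrite (eq_bigl (fun u : pairs l * 'I_N => true && (u.2 < AA u.1))).
      rewrite -(pair_big_dep xpredT (fun p (z : 'I_N) => z < AA p) (fun _ _ => 1)) /=.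
      by apply: leq_sum => p _; rewrite sum_ord_lt geq_minr.
    by case=> p z; rewrite inE.
  - rewrite (eq_bigl (fun u : 'I_l * 'I_N => true && (A u.1 <= u.2))).
      rewrite -(pair_big_dep xpredT (fun i (y : 'I_N) => A i <= y) (fun _ _ => 1)) /=.
      rewrite (eq_bigr (fun i => N - A i)) => [|i _]; last by rewrite sum_ord_ge.
      rewrite -[l in l * N]card_ord -sum_nat_const -sumnB // => i _.
      by rewrite -ltnS.
    by case=> i y; rewrite inE.
move/leq_trans; apply.
have hA := sum_sizes_le A.
have le_real : ((ie_reduced eps A AA + \sum_p AA p + (l * N - \sum_i A i))%N%:R <=
   (l * N)%:R - eps * N%:R :> R)%R.
  by move: hr; rewrite !natrD natrB // -!natr_sum; lra.
by rewrite /code_bound truncn_ge_nat // (le_trans _ le_real).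
Qed.

(** [c] records which sets contain a point. The pair certifies that the point also lies in a set of
    index smaller than [i]. *)
Definition witness (c : column) (i : 'I_l) : option (pairs l) :=
  [pick p | (snd_idx p == i) && c (fst_idx p)].

Definition first (c : column) : option 'I_l :=
  [pick i | c i && (witness c i == None)].

(** Of two indices in [c] without a witness neither precedes the other, so they coincide. Decoding
    thus recovers the index from the point alone. *)
Lemma firstP (c : column) i : c i -> witness c i = None -> first c = Some i.
Proof.
move=> ci wi; rewrite /first; case: pickP => [j /andP[cj /eqP wj]|/(_ i)]; last first.
  by rewrite ci wi eqxx.
have nolt (i1 i2 : 'I_l) : c i1 -> witness c i2 = None -> ~~ (i1 < i2).
  move=> ci1; rewrite /witness; case: pickP => // nop _; apply/negP => lt12.
  have := nop (Sub (i1, i2) lt12 : pairs l).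
  by rewrite /snd_idx /fst_idx SubK /= eqxx ci1.
congr Some; apply: ord_inj; have := nolt _ _ ci wj; have := nolt _ _ cj wi.
lia.
Qed.

Section Input.
Variable I : ie_input N l eps.

(* Values are read off the bits of the input, so an entry outside of the domain
   and a missing value (None) both count as 0. *)
Definition col (x : 'I_N) : column := [ffun i => ie_T I i x].
Definition vf i (y : 'I_N) : 'I_N := to_ord N0 (entry (@ie_f _ _ _ _ I i) y).
Definition vg i (x : 'I_N) : 'I_N := to_ord N0 (value (ie_g I i x)).
Definition vff p (z : 'I_N) : 'I_N := to_ord N0 (entry (@ie_ff _ _ _ _ I p) z).
Definition vgg p (x : 'I_N) : 'I_N := to_ord N0 (value (ie_gg I p x)).
Definition vft (z : 'I_(l * N)) : 'I_N := to_ord N0 (entry (@ie_ft _ _ _ _ I) z).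
Definition vgt (x : 'I_N) : 'I_(l * N) := to_ord lN0 (value (ie_gt I x)).
Definition params : sizes * pair_sizes := ([ffun i => ie_a I i], [ffun p => ie_aa I p]).

Lemma reduced_params :
  ie_reduced eps params.1 params.2 = ie_reduced eps (ie_a I) (ie_aa I).
Proof.
rewrite /ie_reduced /ie_total; congr (Num.truncn (_%:~R - _)%R).
by congr (_ - _)%R; apply: eq_bigr => i _; rewrite ffunE.
Qed.

End Input.

(** * Encoding, decoding and the search for a solution *)

Definition e0 : 'I_l * 'I_N := (Ordinal l0, Ordinal N0).

(** What has already been queried, here the column [c], is a separate argument, so that
    [computed_bind] can peel off the queries one by one. *)
Definition code_at (i : 'I_l) (x : 'I_N) (c : column) (I : input IE) : code :=
  if witness c i is Some p then inl (inr (p, vgg I p x)) else inl (inl (vgt I x)).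

Definition pre_code (A : sizes) (e : 'I_l * 'I_N) (I : input IE) : code :=
  if A e.1 <= e.2 then inr e
  else let x := vf I e.1 e.2 in code_at e.1 x (col I x) I.

Definition decode_at (x : 'I_N) (c : column) (I : input IE) : 'I_l * 'I_N :=
  if first c is Some i then (i, vg I i x) else e0.

Definition pre_decode (u : code) (I : input IE) : 'I_l * 'I_N :=
  match u with
  | inl (inl z) => let x := vft I z in decode_at x (col I x) I
  | inl (inr (p, z)) => let x := vff I p z in (snd_idx p, vg I (snd_idx p) x)
  | inr e => e
  end.

(** The range test handles a_{i,j} = 0: the missing value reads as 0 and fails the test, and [x] is
    then a solution if it lies in both sets. [check_union] treats an empty range of \tilde g
    likewise. *)
Definition check_pair (AA : pair_sizes) p (x z : 'I_N) (I : input IE) : option (output IE) :=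
  if (z < AA p) && (vff I p z == x) then None else Some (S2 p x).

Definition check_union (r : nat) (x : 'I_N) (z : 'I_(l * N)) (I : input IE) :
    option (output IE) :=
  if (z < r) && (vft I z == x) then None else Some (S3 l x).

Definition solution_at (r : nat) (AA : pair_sizes) (e : 'I_l * 'I_N) (x : 'I_N)
    (c : column) (y : 'I_N) (I : input IE) : option (output IE) :=
  if c e.1 && (y == e.2) then
    if witness c e.1 is Some p then check_pair AA p x (vgg I p x) I
    else check_union r x (vgt I x) I
  else Some (S1 e.1 e.2).

Definition find_solution (A : sizes) (AA : pair_sizes) (e : 'I_l * 'I_N)
    (I : input IE) : option (output IE) :=
  if A e.1 <= e.2 then None
  else let x := vf I e.1 e.2 in
       solution_at (ie_reduced eps A AA) AA e x (col I x) (vg I e.1 x) I.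

(** The rank among the codes valid for the queried sizes lies in a range fixed in advance. Invalid
    codes get a meaningless rank, but occur only where a solution is found. *)
Definition encode (I : input IE) (e : 'I_l * 'I_N) : option 'I_code_bound :=
  insub (index (pre_code (params I).1 e I) (enum (codes (params I).1 (params I).2))).

Definition decode (I : input IE) (k : 'I_code_bound) : 'I_l * 'I_N :=
  pre_decode (nth (inr e0) (enum (codes (params I).1 (params I).2)) k) I.

Definition solution (I : input IE) (e : 'I_l * 'I_N) : option (output IE) :=
  find_solution (params I).1 (params I).2 e I.

Lemma solution_sound I e o : solution I e = Some o -> solves I o.
Proof.
case: e => i y; rewrite /solution /find_solution reduced_params /= ffunE.
case: (leqP (ie_a I i) y) => // lt_ya.
set x := vf I i y; pose y' := Ordinal lt_ya.
have xE : x = ie_f y' by apply: ord_inj; rewrite to_ordK ?ltn_entry // (entry_ord _ y').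
rewrite /solution_at ffunE; case: ifP => [/andP[Tix _]|/negbT nsol [<-]]; last first.
  exists y'; split=> //; rewrite -xE; move: nsol; rewrite negb_and.
  case/orP => [/negPf->|neq]; first by left.
  right=> gx; case/eqP: neq; apply: ord_inj.
  by rewrite to_ordK gx //= (leq_trans lt_ya) // -ltnS.
case wi: (witness _ _) => [p|].
  move: wi; rewrite /witness; case: pickP => // q /andP[/eqP qi Tq] [<-].
  rewrite ffunE in Tq; rewrite /check_pair ffunE; case: ifP => // nsol [<-] /=.
  split=> //; first by rewrite qi.
  (* Were [x] no solution, g_{i,j} would return some [z] with f_{i,j}(z) = x, and the values read
     would pass the check. *)
  case gq: (ie_gg I q x) => [z|] //= [fz]; move/negP: nsol; apply.
  have zE : vgg I q x = z :> nat.
    by rewrite to_ordK gq //= (leq_trans (ltn_ord z)) // -ltnS.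
  rewrite zE ltn_ord /=; apply/eqP/ord_inj.
  by rewrite to_ordK ?ltn_entry // zE entry_ord fz.
rewrite /check_union; case: ifP => // nsol [<-] /=; split; last by exists i.
case gx: (ie_gt I x) => [z|] //= [fz]; move/negP: nsol; apply.
have zE : vgt I x = z :> nat.
  rewrite to_ordK gx //=.
  by rewrite (leq_trans (ltn_ord z)) // ie_reduced_le_lN // ie_gap.
rewrite zE ltn_ord /=; apply/eqP/ord_inj.
by rewrite to_ordK ?ltn_entry // zE entry_ord fz.
Qed.

(** Passed checks put the code in range and lead back to the point [x]. The index is the second
    component of the pair or, without a witness, the least one in the column; g_i then recovers the
    element of [a_i]. *)
Lemma codeK I e : let u := pre_code (params I).1 e I in
  solution I e = None ->
  u \in codes (params I).1 (params I).2 /\ pre_decode u I = e.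
Proof.
case: e => i y; rewrite /solution /find_solution /pre_code inE /=.
case: ifP => // _; set x := vf I i y; rewrite /solution_at /code_at.
case: ifP => // /andP[Tix /eqP gx].
case wi: (witness _ _) => [p|] /=; rewrite ?/check_pair ?/check_union /decode_at; case: ifP => //= /andP[-> /eqP ->] _; split=> //.
  move: wi; rewrite /witness; case: pickP => // q /andP[/eqP qi _] [<-].
  by rewrite qi gx.
by rewrite (firstP Tix wi) gx.
Qed.

Lemma encodeK I e : solution I e = None -> omap (decode I) (encode I e) = Some e.
Proof.
move=> /codeK /= [u_code uK]; rewrite /encode.
have lt_idx : index (pre_code (params I).1 e I)
    (enum (codes (params I).1 (params I).2)) < code_bound.
  apply: (@leq_trans #|codes (params I).1 (params I).2|).
    by rewrite cardE index_mem mem_enum.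
  apply: card_codes; have := ie_gap I; rewrite /ie_total.
  congr (_ <= (_ - _)%:~R)%R; apply: eq_bigr => i _; rewrite ffunE //.
by rewrite insubT /= /decode nth_index ?mem_enum ?uK.
Qed.

(** * Depth of the decision trees *)

Let L := bits N.
(** All sizes are read first. Testing an element then reads a column and at most four values: f_i,
    g_i, one of g_{i,j} and \tilde g, and the matching f_{i,j} or \tilde f. The second [l] pays for
    the longer values of \tilde g. *)
Let D := (l + l * l) * L + 4 * L + 2 * l.

Lemma up_log_sizes : up_log 2 N.+1 <= L.
Proof. by apply: up_log_min => //; apply: ltn_exp_bits. Qed.

Lemma up_log_N : up_log 2 N <= L.
Proof. by apply: up_log_min => //; apply/ltnW/ltn_exp_bits. Qed.

Lemma up_log_lN : up_log 2 (l * N) <= l + L.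
Proof.
apply: up_log_min => //; rewrite expnD leq_mul //; first exact/ltnW/ltn_expl.
exact/ltnW/ltn_exp_bits.
Qed.

Lemma computed_size (P : problem) (q : 'I_(up_log 2 N.+1) -> query P)
    (phi : input P -> 'I_N.+1) :
  (forall x b, bit x (q b) = nbit (phi x) b) -> computed L phi.
Proof.
move=> hq; apply: computed_le up_log_sizes _.
apply: computed_eq (computed_read (ltn0Sn N) (phi := fun x => phi x) _ hq) _ => // x.
by apply: ord_inj; rewrite to_ordK.
Qed.

Lemma computed_params : computed ((l + l * l) * L) (params : input IE -> _).
Proof.
have cardl : #|pairs l| <= l * l.
  rewrite card_sub; apply: leq_trans (max_card _) _.
  by rewrite card_prod card_ord.
apply: (@computed_le _ _ (#|'I_l| * L + (#|pairs l| * L + 0))).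
  by rewrite card_ord addn0 mulnDl leq_add2l leq_mul2r cardl orbT.
apply: (@computed_bind IE _ _ _ _ (fun I => [ffun i => ie_a I i])
  (fun A I => (A, [ffun p => ie_aa I p]))).
  by apply: (computed_ffun ord0) => i; apply: (computed_size (P := IE) (q := @Qa N l i)).
move=> A; apply: (@computed_bind IE _ _ _ _ (fun I => [ffun p => ie_aa I p])
    (fun AA _ => (A, AA))) => [|AA].
  by apply: (computed_ffun ord0) => p; apply: (computed_size (P := IE) (q := @Qaa N l p)).
exact: computed_const.
Qed.

Lemma computed_col x : computed l (fun I : input IE => col I x).
Proof.
have := computed_ffun false (fun i => computed_query (QT i x : query IE)).
by rewrite card_ord muln1.
Qed.

Lemma computed_vf i y : computed L (fun I : input IE => vf I i y).
Proof.
apply: computed_le up_log_N _; apply: (computed_read N0 (q := Qf i y : _ -> query IE)).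
  by move=> I; apply: ltn_entry.
by move=> I b; apply: table_bitE.
Qed.

Lemma computed_vff p z : computed L (fun I : input IE => vff I p z).
Proof.
apply: computed_le up_log_N _; apply: (computed_read N0 (q := Qff p z : _ -> query IE)).
  by move=> I; apply: ltn_entry.
by move=> I b; apply: table_bitE.
Qed.

Lemma computed_vft z : computed L (fun I : input IE => vft I z).
Proof.
apply: computed_le up_log_N _; apply: (computed_read N0 (q := Qft z : _ -> query IE)).
  by move=> I; apply: ltn_entry.
by move=> I b; apply: table_bitE.
Qed.

Lemma computed_vg i x : computed L (fun I : input IE => vg I i x).
Proof.
apply: computed_le up_log_N _; apply: (computed_read N0 (q := Qg i x : _ -> query IE)).
  by move=> I; apply: ltn_value => //; rewrite -ltnS.
by move=> I b; apply: value_bitE.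
Qed.

Lemma computed_vgg p x : computed L (fun I : input IE => vgg I p x).
Proof.
apply: computed_le up_log_N _; apply: (computed_read N0 (q := Qgg p x : _ -> query IE)).
  by move=> I; apply: ltn_value => //; rewrite -ltnS.
by move=> I b; apply: value_bitE.
Qed.

Lemma computed_vgt x : computed (l + L) (fun I : input IE => vgt I x).
Proof.
apply: computed_le up_log_lN _; apply: (computed_read lN0 (q := Qgt x : _ -> query IE)).
  by move=> I; apply: ltn_value (lN0) _; apply: ie_reduced_le_lN (ie_gap I).
by move=> I b; apply: value_bitE.
Qed.

Lemma computed_encode e : computed D (fun I : input IE => encode I e).
Proof.
apply: (@computed_le _ _ ((l + l * l) * L + (L + (l + (l + L))))).
  by rewrite /D; lia.
apply: (computed_bind (psi := fun q (I : input IE) =>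
  insub (index (pre_code q.1 e I) (enum (codes q.1 q.2))) : option 'I_code_bound)).
  exact: computed_params.
move=> [A AA]; apply: (computed_map (fun u => insub (index u (enum (codes A AA))))).
rewrite /pre_code /=; case: (_ <= _); first exact: computed_le (computed_const _ _).
apply: (computed_bind (psi := fun x (I : input IE) => code_at e.1 x (col I x) I)) => [|x].
  exact: computed_vf.
apply: (computed_bind (psi := code_at e.1 x)) => [|c]; first exact: computed_col.
rewrite /code_at; case: (witness c e.1) => [p|].
  apply: (computed_map (fun z => inl (inr (p, z)))).
  by apply: computed_le (computed_vgg _ _); lia.
by apply: (computed_map (fun z => inl (inl z))); apply: computed_vgt.
Qed.

Lemma computed_decode k : computed D (fun I : input IE => decode I k).
Proof.
apply: (@computed_le _ _ ((l + l * l) * L + (L + (l + L)))); first by rewrite /D; lia.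
apply: (computed_bind (psi := fun q (I : input IE) =>
  pre_decode (nth (inr e0) (enum (codes q.1 q.2)) k) I)); first exact: computed_params.
move=> [A AA]; case: (nth _ _ _) => [[z|[p z]]|e] /=.
- apply: (computed_bind (psi := fun x (I : input IE) => decode_at x (col I x) I)) => [|x].
    exact: computed_vft.
  apply: (computed_bind (psi := decode_at x)) => [|c]; first exact: computed_col.
  rewrite /decode_at; case: (first c) => [i|]; last exact: computed_le (computed_const _ _).
  by apply: (computed_map (pair i)); apply: computed_vg.
- apply: (computed_bind (psi := fun x (I : input IE) => (snd_idx p, vg I (snd_idx p) x))) => [|x].
    exact: computed_vff.
  apply: (computed_map (pair _)).
  by apply: computed_le (computed_vg _ _); lia.
- exact: computed_le (computed_const _ _).
Qed.

Lemma computed_solution e : computed D (fun I : input IE => solution I e).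
Proof.
apply: (@computed_le _ _ ((l + l * l) * L + (L + (l + (L + ((l + L) + (L + 0))))))).
  by rewrite /D; lia.
apply: (computed_bind (psi := fun q (I : input IE) => find_solution q.1 q.2 e I)).
  exact: computed_params.
move=> [A AA]; rewrite /find_solution /=.
case: (_ <= _); first exact: computed_le (computed_const _ _).
apply: (computed_bind (psi := fun x (I : input IE) =>
  solution_at (ie_reduced eps A AA) AA e x (col I x) (vg I e.1 x) I)) => [|x].
  exact: computed_vf.
apply: (computed_bind (psi := fun c (I : input IE) =>
  solution_at (ie_reduced eps A AA) AA e x c (vg I e.1 x) I)) => [|c].
  exact: computed_col.
apply: (computed_bind (psi := solution_at _ AA e x c)) => [|y]; first exact: computed_vg.
rewrite /solution_at; case: (_ && _); last exact: computed_le (computed_const _ _).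
case: (witness c e.1) => [p|].
  apply: (computed_bind (psi := check_pair AA p x)) => [|z].
    by apply: computed_le (computed_vgg _ _); lia.
  apply: (computed_bind (psi := fun x' _ =>
    if (z < AA p) && (x' == x) then None else Some (S2 p x))) => [|x'].
    exact: computed_vff.
  exact: computed_const.
apply: (computed_bind (psi := check_union _ x)) => [|z]; first exact: computed_vgt.
apply: (computed_bind (psi := fun x' _ =>
  if (z < ie_reduced eps A AA) && (x' == x) then None else Some (S3 l x))) => [|x'].
  exact: computed_vft.
exact: computed_const.
Qed.

End InclusionExclusionReduction.

(** * The gap and the choice of parameters *)

Lemma code_bound_shrinks (R : archiRealFieldType) (N l P : nat) (eps : R) :
  0 < l -> 0 < P -> (1 / P%:R < eps)%R ->
  code_bound N l eps * (l * P) + l * N <= l * N * (l * P).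
Proof.
move=> l0 P0; rewrite ltr_pdivrMr ?ltr0n // => epsP.
rewrite /code_bound; set r := ((l * N)%:R - eps * N%:R)%R.
have [r0|r_lt0] := leP 0%R r; last first.
  rewrite (_ : Num.truncn r = 0) ?mul0n ?leq_pmulr ?muln_gt0 ?l0 //.
  by apply/eqP; rewrite -leqn0 leqNgt truncn_gt0 -ltNge (lt_trans r_lt0).
have hK : ((Num.truncn r)%:R <= r)%R by rewrite truncn_le.
(* The claim divided by l; it holds since eps P > 1 gives r P <= l N P - N. *)
suff : Num.truncn r * P + N <= l * N * P by nia.
rewrite -(ler_nat R) natrD natrM [X in (_ <= X)%R]natrM.
have P0' : (0 <= P%:R :> R)%R by exact: ler0n.
have := ler_wpM2r P0' hK; rewrite {2}/r.
have := ler_wpM2r (ler0n R N) (ltW epsP).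
lra.
Qed.

Lemma lossy_query_bits (M k : nat) : 0 < M -> M <= 2 ^ k ->
  up_log 2 #|lossy_query M| <= 2 + 2 * k.
Proof.
move=> M0 hM; apply: up_log_min => //; apply: leq_trans (card_lossy_query M0) _.
by rewrite expnD leq_mul2l mulnC expnM leq_exp2r.
Qed.

Theorem theorem6p5 (R : archiRealFieldType) (p : nat -> nat) (hp : polylog p) :
  exists q : nat -> nat, polylog q /\
    forall (N l : nat) (eps : R),
      0 < N -> l <= p N -> (1 / (p N)%:R < eps)%R ->
      exists M : nat, 0 < M /\
        exists r : reduction (inclusion_exclusion N l eps) (lossy_code M),
          complexity r <= q N.
Proof.
(* With l bounded by p(N): the first two terms cover the logarithm of the number of queries for M =
   (l N)^(l p(N)), and the 4 also the case l = 0; the last is the number l p(N) of repetitions times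
   the depth. *)
exists (fun N => 4 + 2 * ((p N + bits N) * (p N * p N)) +
  p N * p N * ((p N + p N * p N) * bits N + 4 * bits N + 2 * p N)).
split.
  by repeat first [exact: hp | exact: polylog_bits | exact: polylog_const
                  | apply: polylogD | apply: polylogM].
move=> N l eps N0 hl heps.
have eps0 : (0 < eps)%R by apply: le_lt_trans heps; rewrite divr_ge0 ?ler0n.
have [l_eq0|l0] := posnP l.
  subst l.
  exists 1; split=> //.
  have noI (I : ie_input N 0 eps) : False.
    (* Without sets \tilde a = 0, against \tilde a >= eps N > 0. *)
    have := ie_gap I; rewrite /ie_total big_ord0 big1 => [|q _]; last first.
      by case: (fst_idx q).
    by rewrite subrr leNgt mulr_gt0 ?ltr0n.
  have [r hr] := empty_reduction (S3 0 (Ordinal N0) : output (inclusion_exclusion N 0 eps)) noI.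
  by exists r; apply: leq_trans hr _; rewrite -addnA leq_addr.
have P0 := leq_trans l0 hl.
have [|r hr] := @lossy_code_reduction (inclusion_exclusion N l eps) _ _ (l * p N) _
  _ _ _ (e0 N0 l0) (S3 l (Ordinal N0)) _
  (computed_encode N0 l0 eps0) (computed_decode N0 l0 eps0)
  (computed_solution N0 l0 eps0)
  (fun I e o => @solution_sound _ _ _ _ _ _ eps0 I e o)
  (fun I e => @encodeK _ _ _ _ _ _ eps0 I e).
  rewrite card_prod !card_ord; apply: double_exp_le; first by rewrite muln_gt0 l0.
  exact: code_bound_shrinks.
move: r hr; rewrite card_prod !card_ord => r hr.
have M0 : 0 < (l * N) ^ (l * p N) by rewrite expn_gt0 muln_gt0 l0 N0.
exists ((l * N) ^ (l * p N)); split=> //.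
exists r; apply: leq_trans hr _; apply: leq_add.
  apply: leq_trans (lossy_query_bits M0 (k := (l + bits N) * (l * p N)) _) _.
    rewrite (expnM 2) leq_exp2r ?muln_gt0 ?l0 // expnD leq_mul //; apply: ltnW.
      exact: ltn_expl.
    exact: ltn_exp_bits.
  rewrite leq_add // leq_mul // leq_mul ?leq_add2r ?leq_mul //.
rewrite !leq_mul // leq_add ?leq_mul // leq_add2r leq_mul // leq_add ?leq_mul //.
Qed.
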